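(* Let $X$ be a finite dimensional real strictly convex normed linear space and let $\{e_1, e_2, \ldots, e_m\}$ be a Hamel basis of $X$ with $\|e_i\| = 1$ for all $i = 1, \ldots, m$. For $i = 1, \ldots, m$ let $$S_i = \{\alpha_{iz} : z = \alpha_{1z} e_1 + \alpha_{2z} e_2 + \cdots + \alpha_{mz} e_m \in S_X\}$$ be the set of $i$-th coordinates of elements of the unit sphere. Then $\{e_1, \ldots, e_m\}$ is a strongly orthonormal Hamel basis in the sense of Birkhoff-James if and only if $\max S_i = 1$ for all $i = 1, 2, \ldots, m$.
   Context: $S_X = \{x \in X : \|x\| = 1\}$ and $B_X = \{x \in X : \|x\| \le 1\}$. $X$ is strictly convex iff every element of $S_X$ is an extreme point of $B_X$. A finite set $\{x_1, \ldots, x_n\}$ in $X$ is a strongly orthonormal set in the sense of Birkhoff-James iff $\|x_i\| = 1$ for each $i$ and, for each $i \in \{1, \ldots, n\}$, $\|x_i\| < \|x_i + \sum_{j=1, j \ne i}^{n} \lambda_j x_j\|$ whenever the scalars $\lambda_j$ ($j \neq i$) are not all $0$. It is a strongly orthonormal Hamel basis in the sense of Birkhoff-James iff it is a Hamel basis of $X$ and a strongly orthonormal set in the sense of Birkhoff-James. *)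

(* Defs.v *)
From HB Require Import structures.
From mathcomp Require Import all_boot all_order all_algebra.
From mathcomp Require Import boolp classical_sets reals topology normedtype.

Set Implicit Arguments.
Unset Strict Implicit.
Unset Printing Implicit Defensive.

Import Order.TTheory GRing.Theory Num.Theory.
Import numFieldNormedType.Exports.

Local Open Scope classical_set_scope.
Local Open Scope ring_scope.

(* Finite-dimensional normed spaces: the norm comes from NormedModule, and
   bases and coordinates ([basis_of], [coord]) from Vector. *)
#[short(type="normedVectType")]
HB.structure Definition NormedVector (K : numFieldType) :=
  {T of NormedModule K T & Vector K T}.

Definition unit_sphere (K : numFieldType) (X : normedModType K) : set X :=
  [set x : X | `|x| = 1].

Definition unit_ball (K : numFieldType) (X : normedModType K) : set X :=
  [set x : X | `|x| <= 1].

Definition extreme_point (K : numFieldType) (X : lmodType K)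
    (A : set X) (x : X) : Prop :=
  A x /\ forall (y z : X) (t : K), A y -> A z -> 0 < t < 1 ->
    x = t *: y + (1 - t) *: z -> y = x /\ z = x.

Definition strictly_convex (K : numFieldType) (X : normedModType K) : Prop :=
  forall x : X, unit_sphere x -> extreme_point (@unit_ball K X) x.

(* The finite set is given as a tuple; a repeated vector is excluded by the
   second clause (take the coefficient -1 at the repetition). *)
Definition strongly_orthonormal_BJ (K : numFieldType) (X : normedModType K)
    (n : nat) (x : n.-tuple X) : Prop :=
  (forall i : 'I_n, `|x`_i| = 1) /\
  (forall (i : 'I_n) (l : 'I_n -> K),
     (exists2 j : 'I_n, j != i & l j != 0) ->
     `|x`_i| < `|x`_i + \sum_(j < n | j != i) l j *: x`_j|).

Definition strongly_orthonormal_Hamel_basis_BJ (K : numFieldType)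
    (X : normedVectType K) (n : nat) (x : n.-tuple X) : Prop :=
  basis_of {:X} x /\ strongly_orthonormal_BJ x.

Definition sphere_coords (K : numFieldType) (X : normedVectType K)
    (n : nat) (e : n.-tuple X) (i : 'I_n) : set K :=
  [set coord e i z | z in @unit_sphere K X].

(* [is_max A a] reads "max A exists and equals a". *)
Definition is_max (K : numFieldType) (A : set K) (a : K) : Prop :=
  A a /\ ubound A a.

(* Main.v *)
(* A vector with i-th coordinate 1 normalizes to a point of the unit sphere with
   i-th coordinate 1/|u|, so max S_i = 1 says exactly that |u| >= 1 for all such
   u, that is |e_i| <= |e_i + sum_(j != i) l_j e_j|. Strict convexity makes the
   inequality strict: if w has i-th coordinate 1, |w| = 1 and w <> e_i, then the
   midpoint of w and e_i also has i-th coordinate 1, hence norm 1, and it is not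
   an extreme point of the ball. *)
Require Import Defs.
From mathcomp Require Import all_boot all_order all_algebra.
From mathcomp Require Import boolp classical_sets reals topology normedtype.
From mathcomp Require Import lra.

Import Order.TTheory GRing.Theory Num.Theory.
Import numFieldNormedType.Exports.

Local Open Scope classical_set_scope.
Local Open Scope ring_scope.

Lemma norm_ge1_of_coord1 (K : numFieldType) (X : normedVectType K) (n : nat)
    (e : n.-tuple X) (i : 'I_n) (u : X) :
  ubound (sphere_coords e i) 1 -> coord e i u = 1 -> 1 <= `|u|.
Proof.
move=> ub1 ui1.
have u_gt0 : 0 < `|u|.
  rewrite normr_gt0; apply/eqP => u0.
  by move: ui1; rewrite u0 linear0 => /eqP; rewrite eq_sym oner_eq0.
have : `|u|^-1 <= 1.
  apply: ub1; exists (`|u|^-1 *: u); last by rewrite linearZ /= ui1 mulr1.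
  by rewrite /unit_sphere /= normrZ normfV normr_id mulVf ?gt_eqF.
by rewrite invf_le1.
Qed.

Lemma coord_add_off_diag (K : fieldType) (X : vectType K) (n : nat)
    (e : n.-tuple X) (i : 'I_n) (l : 'I_n -> K) (k : 'I_n) :
  free e ->
  coord e k (e`_i + \sum_(j < n | j != i) l j *: e`_j) =
    if k == i then 1 else l k.
Proof.
move=> fe.
have -> : e`_i + \sum_(j < n | j != i) l j *: e`_j =
    \sum_(j < n) (if j == i then 1 else l j) *: e`_j.
  rewrite [RHS](bigD1 i) //= eqxx scale1r; congr (_ + _).
  by apply: eq_bigr => j /negPf ->.
exact: coord_sum_free.
Qed.

(** The triangle inequality bounds the norm of the midpoint by 1, so the midpoint lies on the
    sphere. It is then an extreme point of the ball, and both ends coincide with it. *)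
Lemma strictly_convex_midpoint (R : realFieldType) (X : normedModType R)
    (x y : X) :
  strictly_convex X -> `|x| <= 1 -> `|y| <= 1 ->
  1 <= `|2^-1 *: x + 2^-1 *: y| -> x = y.
Proof.
move=> hX x1 y1 mid_ge1.
have half : 1 - 2^-1 = 2^-1 :> R by lra.
have mid_le1 : `|2^-1 *: x + 2^-1 *: y| <= 1.
  apply: le_trans (ler_normD _ _) _.
  by rewrite !normrZ ger0_norm; lra.
have /hX [_ ext] : unit_sphere (2^-1 *: x + 2^-1 *: y).
  by apply/eqP; rewrite eq_le mid_le1.
have half01 : 0 < (2^-1 : R) < 1 by lra.
have [|xm ym] := ext x y 2^-1 x1 y1 half01; first by rewrite half.
exact: etrans xm (esym ym).
Qed.

Theorem theorem3p3 (R : realType) (X : normedVectType R) (m : nat)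
    (e : m.-tuple X)
    (hX : strictly_convex X)
    (he : basis_of {:X} e)
    (he1 : forall i : 'I_m, `|e`_i| = 1) :
  strongly_orthonormal_Hamel_basis_BJ e <->
  (forall i : 'I_m, is_max (sphere_coords e i) 1).
Proof.
have fe : free e := basis_free he.
have coord_ei i : coord e i e`_i = 1 by rewrite coord_free // eqxx.
split=> [[_ [_ so]] i | maxS].
  split; first by exists e`_i.
  move=> _ [z z1 <-].
  have [ai_le0|ai_gt0] := leP (coord e i z) 0; first exact: le_trans ai_le0 _.
  set a := coord e i z in ai_gt0 *.
  (* Dividing [z] by [a] makes its [i]-th coordinate 1, the shape to which strong orthonormality
     applies. *)
  pose l j := a^-1 * coord e j z.
  have def_z : a^-1 *: z = e`_i + \sum_(j < m | j != i) l j *: e`_j.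
    rewrite {1}(coord_basis he (memvf z)) scaler_sumr (bigD1 i) //=.
    rewrite scalerA mulVf ?gt_eqF // scale1r; congr (_ + _).
    by apply: eq_bigr => j _; rewrite scalerA.
  have : 1 <= `|a^-1 *: z|.
    (* Strong orthonormality needs some nonzero coefficient off [i]; otherwise the vector is [e_i]
       itself, of norm 1. *)
    have [[j jPi lj0]|l0] := pselect (exists2 j, j != i & l j != 0).
      by rewrite def_z -(he1 i); apply/ltW/so; exists j.
    rewrite def_z big1 ?addr0 ?he1 // => j jPi.
    have [->|lj0] := eqVneq (l j) 0; first by rewrite scale0r.
    by case: l0; exists j.
  (* Since [z] has norm 1, the bound reads [1 <= a^-1]. *)
  by rewrite normrZ z1 mulr1 normfV gtr0_norm // invf_ge1.
split=> //; split=> // i l [j jPi lj0].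
set w := _ + _.
have coord_w k : coord e k w = if k == i then 1 else l k.
  exact: coord_add_off_diag.
have ub1 : ubound (sphere_coords e i) 1 by case: (maxS i).
have wi : coord e i w = 1 by rewrite coord_w eqxx.
rewrite he1 ltNge; apply/negP => w_le1.
(* The midpoint of [w] and [e_i] again has [i]-th coordinate 1, hence norm at least 1. *)
have w_ei : w = e`_i.
  apply: strictly_convex_midpoint; rewrite ?he1 //.
  apply: (norm_ge1_of_coord1 _ _ _ _ _ _ ub1).
  by rewrite linearD !linearZ /= wi coord_ei; lra.
(* The [j]-th coordinate is 0 for [e_i] but [l j != 0] for [w]. *)
move: (coord_w j); rewrite w_ei coord_free // (negPf jPi) eq_sym => lj.
by move: lj0; rewrite -lj (negPf jPi) eqxx.
Qed.
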